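(* Let $\mathcal{RRB}$ and $\mathcal{RB}$ denote the categories of relative Rota--Baxter groups and Rota--Baxter groups, respectively. Then the association $\mathcal{F}:\mathcal{RRB}\to\mathcal{RB}$ given by $$\mathcal{F}\big((H,G,\phi,R)\big)=\big(H\rtimes_\phi G,\ \widetilde R\big)$$ is a covariant functor.
   Context: A Rota--Baxter group is a pair $(G,R)$ where $G$ is a group and $R:G\to G$ is a map with $R(x)R(y)=R\big(xR(x)yR(x)^{-1}\big)$ for all $x,y\in G$. A homomorphism $(G,R_G)\to(H,R_H)$ of Rota--Baxter groups is a group homomorphism $\psi:G\to H$ with $\psi R_G=R_H\psi$. A relative Rota--Baxter group is a quadruple $(H,G,\phi,R)$ where $H,G$ are groups, $\phi:G\to\mathrm{Aut}(H)$, $g\mapsto\phi_g$, is a group homomorphism and $R:H\to G$ is a map with $R(h_1)R(h_2)=R\big(h_1\phi_{R(h_1)}(h_2)\big)$ for all $h_1,h_2\in H$. A homomorphism $(H,G,\phi,R)\to(K,L,\varphi,S)$ of relative Rota--Baxter groups is a pair $(f_1,f_2)$ of group homomorphisms $f_1:H\to K$, $f_2:G\to L$ such that $f_2R=Sf_1$ and $f_1\phi_g=\varphi_{f_2(g)}f_1$ for all $g\in G$. The semi-direct product $H\rtimes_\phi G$ is the set $H\times G$ with multiplication $(h_1,g_1)(h_2,g_2)=(h_1\phi_{g_1}(h_2),g_1g_2)$. For a relative Rota--Baxter group $(H,G,\phi,R)$, the map $\widetilde R:H\rtimes_\phi G\to H\rtimes_\phi G$ is given by $\widetilde R\big((h,g)\big)=\big(1,\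 g^{-1}R(h)\big)$ for $h\in H$, $g\in G$; it is known to be a Rota--Baxter operator on $H\rtimes_\phi G$. *)

(* Defs.v *)
From HB Require Import structures.
From mathcomp Require Import all_boot.
From mathcomp Require Import boolp.

Set Implicit Arguments.
Unset Strict Implicit.
Unset Printing Implicit Defensive.

Import Algebra.
Local Open Scope group_scope.

(* Groups are arbitrary, possibly infinite, [groupType]s.  A homomorphism of
   groups is a [{multiplicative G -> H}]: preservation of products implies
   that of 1 and of inverses. *)

Lemma multiplicative_eq (G H : magmaType) (f g : {multiplicative G -> H}) :
  f =1 g -> f = g.
Proof.
case: f => f [[fM]]; case: g => g [[gM]] /= /funext fg.
rewrite -{}fg in gM *; by rewrite (Prop_irrelevance gM fM).
Qed.

Section Automorphisms.
Variable H : groupType.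

Record Aut := MkAut {
  aut_fun :> {multiplicative H -> H};
  aut_bij : bijective aut_fun }.

Lemma aut_eq (a b : Aut) : a =1 b -> a = b.
Proof.
case: a b => [f fP] [g gP] /= /multiplicative_eq fg.
by rewrite -{}fg in gP *; rewrite (Prop_irrelevance gP fP).
Qed.

Definition aut_one : Aut :=
  @MkAut (idfun : {multiplicative H -> H}) 
    (@Bijective _ _ idfun idfun (fun=> erefl) (fun=> erefl)).

Definition aut_mul (a b : Aut) : Aut :=
  @MkAut (a \o b : {multiplicative H -> H}) (bij_comp (aut_bij a) (aut_bij b)).

Lemma aut_inv_ex (a : Aut) : exists b : Aut, cancel a b /\ cancel b a.
Proof.
have [g aK gK] := aut_bij a.
pose gM := isMultiplicative.Build H H g (can2_gmulfM aK gK).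
pose g' : {multiplicative H -> H} := HB.pack g gM.
by exists (@MkAut g' (Bijective gK aK)).
Qed.

Definition aut_inv (a : Aut) : Aut := sval (cid (aut_inv_ex a)).

Lemma aut_invK (a : Aut) : cancel a (aut_inv a) /\ cancel (aut_inv a) a.
Proof. exact: svalP (cid (aut_inv_ex a)). Qed.

Lemma aut_mulA : associative aut_mul.
Proof. by move=> a b c; apply: aut_eq. Qed.

Lemma aut_mul1 : left_id aut_one aut_mul.
Proof. by move=> a; apply: aut_eq. Qed.

Lemma aut_mulr1 : right_id aut_one aut_mul.
Proof. by move=> a; apply: aut_eq. Qed.

Lemma aut_mulV : left_inverse aut_one aut_inv aut_mul.
Proof. by move=> a; apply: aut_eq => x /=; rewrite (aut_invK a).1. Qed.

Lemma aut_mulrV : right_inverse aut_one aut_inv aut_mul.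
Proof. by move=> a; apply: aut_eq => x /=; rewrite (aut_invK a).2. Qed.

HB.instance Definition _ := gen_eqMixin Aut.
HB.instance Definition _ := gen_choiceMixin Aut.
HB.instance Definition _ := isGroup.Build Aut
  aut_mulA aut_mul1 aut_mulr1 aut_mulV aut_mulrV.

End Automorphisms.

Lemma autME (H : groupType) (a b : Aut H) (x : H) : (a * b) x = a (b x).
Proof. by []. Qed.

Lemma aut1E (H : groupType) (x : H) : (1 : Aut H) x = x.
Proof. by []. Qed.

Lemma mult1 (G H : groupType) (f : {multiplicative G -> H}) : f 1 = 1.
Proof. by apply: (@mulgI _ (f 1)); rewrite -gmulfM !mulg1. Qed.

(* [sdprod phi] is an alias of [H * G], which already carries the structure of
   the direct product. *)
Definition sdprod (H G : groupType) (phi : {multiplicative G -> Aut H}) : Type :=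
  (H * G)%type.

Section SemidirectProduct.
Variables (H G : groupType) (phi : {multiplicative G -> Aut H}).
Implicit Types x y : sdprod phi.

Definition sdprod_one : sdprod phi := (1, 1).
Definition sdprod_mul x y : sdprod phi := (x.1 * phi x.2 y.1, x.2 * y.2).
Definition sdprod_inv x : sdprod phi := (phi x.2^-1 x.1^-1, x.2^-1).

Lemma sdprod_mulA : associative sdprod_mul.
Proof.
move=> [h1 g1] [h2 g2] [h3 g3]; congr (_, _); last exact: mulgA.
by rewrite /= !gmulfM autME mulgA.
Qed.

Lemma sdprod_mul1 : left_id sdprod_one sdprod_mul.
Proof. by move=> [h g]; rewrite /sdprod_mul /= mult1 aut1E !mul1g. Qed.

Lemma sdprod_mulr1 : right_id sdprod_one sdprod_mul.
Proof. by move=> [h g]; rewrite /sdprod_mul /= mult1 !mulg1. Qed.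

Lemma sdprod_mulV : left_inverse sdprod_one sdprod_inv sdprod_mul.
Proof.
by move=> [h g]; rewrite /sdprod_mul /= -gmulfM !mulVg mult1.
Qed.

Lemma sdprod_mulrV : right_inverse sdprod_one sdprod_inv sdprod_mul.
Proof.
by move=> [h g]; rewrite /sdprod_mul /= -autME -gmulfM !mulgV mult1 aut1E mulgV.
Qed.

HB.instance Definition _ := Choice.on (sdprod phi).
HB.instance Definition _ := isGroup.Build (sdprod phi)
  sdprod_mulA sdprod_mul1 sdprod_mulr1 sdprod_mulV sdprod_mulrV.

End SemidirectProduct.

Definition rb_operator (G : groupType) (R : G -> G) : Prop :=
  forall x y, R x * R y = R (x * R x * y * (R x)^-1).

Record rbGroup := RBGroup {
  rb_group :> groupType;
  rb_op : rb_group -> rb_group;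
  rb_opP : rb_operator rb_op }.

Record rbHom (X Y : rbGroup) := RBHom {
  rbhom_fun :> {multiplicative X -> Y};
  rbhomP : forall x : X, rbhom_fun (rb_op x) = rb_op (rbhom_fun x) }.

Definition rrb_operator (H G : groupType) (phi : {multiplicative G -> Aut H})
    (R : H -> G) : Prop :=
  forall h1 h2, R h1 * R h2 = R (h1 * phi (R h1) h2).

Record rrbGroup := RRBGroup {
  rrb_H : groupType;
  rrb_G : groupType;
  rrb_phi : {multiplicative rrb_G -> Aut rrb_H};
  rrb_op : rrb_H -> rrb_G;
  rrb_opP : rrb_operator rrb_phi rrb_op }.

Record rrbHom (X Y : rrbGroup) := RRBHom {
  rrbhom1 : {multiplicative rrb_H X -> rrb_H Y};
  rrbhom2 : {multiplicative rrb_G X -> rrb_G Y};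
  rrbhom_op : forall h : rrb_H X, rrbhom2 (rrb_op h) = rrb_op (rrbhom1 h);
  rrbhom_phi : forall (g : rrb_G X) (h : rrb_H X),
    rrbhom1 (rrb_phi X g h) = rrb_phi Y (rrbhom2 g) (rrbhom1 h) }.

Record category := Category {
  obj :> Type;
  hom : obj -> obj -> Type;
  idm : forall X, hom X X;
  comp : forall X Y Z, hom Y Z -> hom X Y -> hom X Z;
  comp1m : forall X Y (f : hom X Y), comp (idm Y) f = f;
  compm1 : forall X Y (f : hom X Y), comp f (idm X) = f;
  compmA : forall X Y Z T (f : hom Z T) (g : hom Y Z) (h : hom X Y),
    comp f (comp g h) = comp (comp f g) h }.

Definition is_functor (C D : category) (F0 : C -> D)
    (F1 : forall X Y : C, hom X Y -> hom (F0 X) (F0 Y)) : Prop :=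
  (forall X : C, F1 X X (idm X) = idm (F0 X)) /\
  (forall (X Y Z : C) (f : hom Y Z) (g : hom X Y),
     F1 X Z (comp f g) = comp (F1 Y Z f) (F1 X Y g)).

Lemma rbhom_eq (X Y : rbGroup) (f g : rbHom X Y) : f =1 g -> f = g.
Proof.
case: f g => [f fP] [g gP] /= /multiplicative_eq fg.
by rewrite -{}fg in gP *; rewrite (Prop_irrelevance gP fP).
Qed.

Lemma rrbhom_eq (X Y : rrbGroup) (f g : rrbHom X Y) :
  rrbhom1 f =1 rrbhom1 g -> rrbhom2 f =1 rrbhom2 g -> f = g.
Proof.
case: f g => [f1 f2 fR fphi] [g1 g2 gR gphi] /=.
move=> /multiplicative_eq fg1 /multiplicative_eq fg2.
rewrite -{}fg1 -{}fg2 in gR gphi *.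
by rewrite (Prop_irrelevance gR fR) (Prop_irrelevance gphi fphi).
Qed.

Definition rb_id (X : rbGroup) : rbHom X X :=
  @RBHom X X (idfun : {multiplicative X -> X}) (fun=> erefl).

Lemma rb_comp_subproof (X Y Z : rbGroup) (f : rbHom Y Z) (g : rbHom X Y)
  (x : X) : (f \o g) (rb_op x) = rb_op ((f \o g) x).
Proof. by rewrite /= !rbhomP. Qed.

Definition rb_comp (X Y Z : rbGroup) (f : rbHom Y Z) (g : rbHom X Y) :
    rbHom X Z :=
  @RBHom X Z (f \o g : {multiplicative X -> Z}) (rb_comp_subproof f g).

Lemma rb_comp1m (X Y : rbGroup) (f : rbHom X Y) :
  rb_comp (rb_id Y) f = f.
Proof. exact: rbhom_eq. Qed.

Lemma rb_compm1 (X Y : rbGroup) (f : rbHom X Y) :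
  rb_comp f (rb_id X) = f.
Proof. exact: rbhom_eq. Qed.

Lemma rb_compmA (X Y Z T : rbGroup) (f : rbHom Z T) (g : rbHom Y Z)
  (h : rbHom X Y) :
  rb_comp f (rb_comp g h) = rb_comp (rb_comp f g) h.
Proof. exact: rbhom_eq. Qed.

Definition RB : category :=
  Category rb_comp1m rb_compm1 rb_compmA.

Definition rrb_id (X : rrbGroup) : rrbHom X X :=
  @RRBHom X X (idfun : {multiplicative rrb_H X -> rrb_H X})
    (idfun : {multiplicative rrb_G X -> rrb_G X})
    (fun=> erefl) (fun _ _ => erefl).

Section RRBComp.
Variables (X Y Z : rrbGroup) (f : rrbHom Y Z) (g : rrbHom X Y).

Lemma rrb_comp_op (h : rrb_H X) :
  (rrbhom2 f \o rrbhom2 g) (rrb_op h) = rrb_op ((rrbhom1 f \o rrbhom1 g) h).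
Proof. by rewrite /= !rrbhom_op. Qed.

Lemma rrb_comp_phi (a : rrb_G X) (h : rrb_H X) :
  (rrbhom1 f \o rrbhom1 g) (rrb_phi X a h) =
  rrb_phi Z ((rrbhom2 f \o rrbhom2 g) a) ((rrbhom1 f \o rrbhom1 g) h).
Proof. by rewrite /= !rrbhom_phi. Qed.

Definition rrb_comp : rrbHom X Z :=
  @RRBHom X Z (rrbhom1 f \o rrbhom1 g : {multiplicative rrb_H X -> rrb_H Z})
    (rrbhom2 f \o rrbhom2 g : {multiplicative rrb_G X -> rrb_G Z})
    rrb_comp_op rrb_comp_phi.

End RRBComp.

Lemma rrb_comp1m (X Y : rrbGroup) (f : rrbHom X Y) :
  rrb_comp (rrb_id Y) f = f.
Proof. exact: rrbhom_eq. Qed.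

Lemma rrb_compm1 (X Y : rrbGroup) (f : rrbHom X Y) :
  rrb_comp f (rrb_id X) = f.
Proof. exact: rrbhom_eq. Qed.

Lemma rrb_compmA (X Y Z T : rrbGroup) (f : rrbHom Z T) (g : rrbHom Y Z)
  (h : rrbHom X Y) :
  rrb_comp f (rrb_comp g h) = rrb_comp (rrb_comp f g) h.
Proof. exact: rrbhom_eq. Qed.

Definition RRB : category :=
  Category rrb_comp1m rrb_compm1 rrb_compmA.

Section SemidirectRotaBaxter.
Variable X : rrbGroup.

Definition sdprod_op (x : sdprod (rrb_phi X)) : sdprod (rrb_phi X) :=
  (1, x.2^-1 * rrb_op x.1).

Lemma sdprod_opP : rb_operator sdprod_op.
Proof.
move=> [h g] [k l]; congr (_, _); first by rewrite /= mult1 mulg1.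
rewrite /= invg1 !mult1 !mulg1 mulVKg -rrb_opP.
by rewrite !invgM !invgK !mulgA !mulgVK.
Qed.

Definition sdprod_rb : rbGroup := RBGroup sdprod_opP.

End SemidirectRotaBaxter.

(* Main.v *)
Require Import Defs.
From HB Require Import structures.
From mathcomp Require Import all_boot.

(** A morphism [(f1, f2)] of relative Rota--Baxter groups is sent to
    [f1 x f2 : (h, g) |-> (f1 h, f2 g)].  The two compatibility conditions on
    [(f1, f2)] are exactly what makes this a morphism of Rota--Baxter groups:
    equivariance, [f1 (phi_g h) = phi_(f2 g) (f1 h)], makes it multiplicative
    for the twisted product ([sdprod_map_mul]), and [f2 R = S f1] makes it
    commute with the operators [(h, g) |-> (1, g^-1 R(h))] ([sdprod_map_op]).
    Functoriality is then immediate, because identities and composites are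
    computed in each coordinate, and a morphism of Rota--Baxter groups is
    determined by its underlying function. *)

Import Algebra.
Local Open Scope group_scope.

Lemma multV (G H : groupType) (f : {multiplicative G -> H}) (x : G) :
  f x^-1 = (f x)^-1.
Proof. by apply: (@mulgI _ (f x)); rewrite -gmulfM !mulgV mult1. Qed.

Section SemidirectMap.
Variables (X Y : rrbGroup) (f : rrbHom X Y).

Definition sdprod_map (x : sdprod_rb X) : sdprod_rb Y :=
  (rrbhom1 f x.1, rrbhom2 f x.2).

(** In the first coordinate, [f1 (h1 * phi_g1 h2) = f1 h1 * phi_(f2 g1) (f1 h2)]
    is where equivariance enters. *)
Lemma sdprod_map_mul (x y : sdprod_rb X) :
  sdprod_map (x * y) = sdprod_map x * sdprod_map y.
Proof.
case: x y => [h1 g1] [h2 g2]; congr (_, _); rewrite /= gmulfM //.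
by rewrite rrbhom_phi.
Qed.

HB.instance Definition _ :=
  isMultiplicative.Build (sdprod_rb X) (sdprod_rb Y) sdprod_map sdprod_map_mul.

Lemma sdprod_map_op (x : sdprod_rb X) :
  sdprod_map (rb_op x) = rb_op (sdprod_map x).
Proof.
case: x => [h g]; congr (_, _); rewrite /= ?mult1 //.
by rewrite gmulfM multV rrbhom_op.
Qed.

Definition sdprod_hom : rbHom (sdprod_rb X) (sdprod_rb Y) :=
  @RBHom _ _ (sdprod_map : {multiplicative sdprod_rb X -> sdprod_rb Y})
    sdprod_map_op.

End SemidirectMap.

(* [F1] is the action on morphisms: (f1, f2) is sent to the map
   (h, g) |-> (f1 h, f2 g). *)
Theorem proposition3p2 :
  exists F1 : forall X Y : RRB,
      @hom RRB X Y -> @hom RB (sdprod_rb X) (sdprod_rb Y),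
    (forall (X Y : rrbGroup) (f : rrbHom X Y) (h : rrb_H X) (g : rrb_G X),
       (F1 X Y f : rbHom (sdprod_rb X) (sdprod_rb Y)) (h, g)
       = (rrbhom1 f h, rrbhom2 f g)) /\
    @is_functor RRB RB sdprod_rb F1.
Proof.
exists sdprod_hom; split=> //; split=> [X | X Y Z f g].
  by apply: rbhom_eq => -[h g].
by apply: rbhom_eq => -[h k].
Qed.
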